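(* Let $(v(n))_{n\ge0}$ be the integer sequence defined by $v(0)=1$ and $$v(n)=2^{n-1}\prod_{j=1}^n(4j-3)^2-\frac12\sum_{m=1}^{n-1}\binom{2n}{2m}v(m)v(n-m)\quad(n\ge1).$$ Then, given a prime $p\equiv1\pmod4$ and a positive integer $e$, the number $v(n)$ is divisible by $p^e$ for all $n\ge\left\lceil\frac{ep}{2}\right\rceil$. *)

(* Defs.v *)
From mathcomp Require Import all_boot all_order all_algebra.

Set Implicit Arguments.
Unset Strict Implicit.
Unset Printing Implicit Defensive.

Import Order.TTheory GRing.Theory Num.Theory.
Local Open Scope ring_scope.

(* The equation is taken in rat, where the factor 1/2 is literal; the values of
   v are integers.  Under 1 <= n the natural number n.-1 is n - 1, and under
   1 <= m < n the index (n - m)%N is not truncated. *)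
Definition v_recurrence (v : nat -> int) : Prop :=
  v 0%N = 1 /\
  forall n : nat, (1 <= n)%N ->
    (v n)%:~R =
      2 ^+ n.-1 * \prod_(1 <= j < n.+1) (4 * j%:R - 3) ^+ 2
      - 1 / 2 * \sum_(1 <= m < n)
                  'C(2 * n, 2 * m)%:R * (v m)%:~R * (v (n - m)%N)%:~R :> rat.

(* v_prefix n is [:: v 0; ...; v n]; the division by 2 is exact, because the
   sum is symmetric under m <-> n - m and the central coefficient
   'C(2 * n, n) is even. *)
Fixpoint v_prefix (n : nat) : seq int :=
  if n is n'.+1 then
    let s := v_prefix n' in
    rcons s (2 ^+ n' * \prod_(1 <= j < n.+1) (4 * j%:R - 3) ^+ 2
             - ((\sum_(1 <= m < n)
                   'C(2 * n, 2 * m)%:R * s`_m * s`_(n - m)) %/ 2)%Z)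
  else [:: 1].

Lemma size_v_prefix n : size (v_prefix n) = n.+1.
Proof. by elim: n => //= n IH; rewrite size_rcons IH. Qed.

Lemma nth_v_prefix n m : (m <= n)%N -> (v_prefix n)`_m = (v_prefix m)`_m.
Proof.
elim: n => [|n IH]; first by rewrite leqn0 => /eqP->.
rewrite leq_eqVlt => /orP[/eqP-> //|]; rewrite ltnS => mn /=.
by rewrite nth_rcons size_v_prefix ltnS mn IH.
Qed.

Lemma even_bin_middle n : (0 < n)%N -> (2 %| 'C(2 * n, n))%N.
Proof.
case: n => // n _; rewrite mul2n doubleS binS.
have -> : 'C(n.*2.+1, n.+1) = 'C(n.*2.+1, n).
  rewrite -(@bin_sub n.*2.+1 n.+1) ?ltnS -?addnn ?leq_addr //.
  by rewrite subSS addnK.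
by rewrite addnn -mul2n dvdn_mulr.
Qed.

Lemma even_sym_sum (a : nat -> int) n :
    (forall m, (0 < m < n)%N -> a (n - m)%N = a m) ->
    (forall m, (0 < m < n)%N -> n = (2 * m)%N -> (2 %| a m)%Z) ->
  (2 %| \sum_(1 <= m < n) a m)%Z.
Proof.
move=> sym mid.
rewrite (bigID (fun m => 2 * m < n)%N) /=.
rewrite [X in _ + X](bigID (fun m => 2 * m == n)%N) /= addrCA.
apply: rpredD.
  rewrite big_nat_cond; apply: rpred_sum => m /andP[mn /andP[_ /eqP e]].
  by apply: mid.
have -> : \sum_(1 <= m < n | ~~ (2 * m < n)%N && (2 * m != n)%N) a m =
          \sum_(1 <= m < n | (2 * m < n)%N) a m.
  rewrite big_nat_rev /= big_nat_cond [RHS]big_nat_cond.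
  have E m : (1 <= m < n)%N -> (1 + n - m.+1 = n - m)%N by rewrite add1n subSS.
  apply: eq_big => [m|m /andP[mn _]]; last by rewrite E // sym.
  case: (boolP (1 <= m < n)%N) => //= mn; rewrite E //.
  case/andP: mn => m0 mn; rewrite -leqNgt andbC eq_sym -ltn_neqAle.
  by rewrite mulnBr ltn_subRL (mul2n n) -addnn ltn_add2r.
by rewrite -mulr2n; apply/dvdzP; eexists; rewrite mulr_natr.
Qed.

Lemma v_recurrence_exists : exists v : nat -> int, v_recurrence v.
Proof.
exists (fun n => (v_prefix n)`_n); split=> // -[//|n] _ /=.
rewrite nth_rcons size_v_prefix ltnn eqxx.
set S := \sum_(1 <= m < n.+1) _.
have SE : S = \sum_(1 <= m < n.+1) 'C(2 * n.+1, 2 * m)%:R *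
              (v_prefix m)`_m * (v_prefix (n.+1 - m))`_(n.+1 - m).
  apply: eq_big_nat => m /andP[m0 mn]; rewrite !nth_v_prefix //.
  by rewrite leq_subLR -add1n leq_add2r.
have dS : (2 %| S)%Z.
  rewrite SE; apply: even_sym_sum => m /andP[m0 mn].
    rewrite subKn ?(ltnW mn) // mulnBr bin_sub ?leq_mul2l ?(ltnW mn) ?orbT //.
    by rewrite mulrAC.
  move=> e; rewrite -mulrA dvdz_mulr // -e natz.
  exact: even_bin_middle.
rewrite rmorphB rmorphM rmorphXn rmorph_prod /=; congr (_ * _ - _).
  by apply: eq_bigr => j _; rewrite rmorphXn rmorphB rmorphM /= !rmorph_nat.
transitivity (1 / 2 * (S%:~R : rat)).
  by rewrite -[in RHS](divzK dS) rmorphM /= rmorph_nat mul1r mulrCA mulVf ?mulr1.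
congr (_ * _); rewrite SE rmorph_sum; apply: eq_bigr => m _.
by rewrite !rmorphM /= rmorph_nat.
Qed.

Lemma v_recurrence_unique v w : v_recurrence v -> v_recurrence w -> v =1 w.
Proof.
move=> [v0 vS] [w0 wS] n; elim/ltn_ind: n => -[|n] IH; first by rewrite v0 w0.
apply: (@intr_inj rat); rewrite vS // wS //; congr (_ - _ * _).
apply: eq_big_nat => m /andP[m0 mn]; rewrite !IH // ltn_subrL.
by rewrite m0.
Qed.

(* Main.v *)
Require Import Defs.
From mathcomp Require Import all_boot all_order all_algebra.
From mathcomp Require Import zify ring.

(** Put [c n = v n / (2n)!].  Multiplying the recurrence by 2 and absorbing the
    two end terms of the convolution turns it into
    [V(t)^2 = sum_n 2^n (1 * 5 * ... * (4n-3))^2 t^(2n) / (2n)!],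
    where [V(t) = sum_n c n t^(2n)].  When [p = 1 mod 4] the right-hand side has
    [p]-integral coefficients, that is,
    [logn p (2n)! <= 2 logn p (1 * 5 * ... * (4n-3))]
    ([logn_fact_double_le]): every power [d] of [p] is again [1 mod 4], so it is
    the term of index [(d-1)/4] of the progression [1, 5, 9, ...], and from
    there on the multiples of [d] recur every [d] terms.  The first of them
    arrives within the first half of a period, so there are at least half as
    many among the first [n] terms as there are multiples of [d] up to [2n].

    As [p] is odd and [V(0) = 1], the square root [V] then has [p]-integral
    coefficients as well; this means that the [p]-part of [(2n)!] divides [v n]
    ([v_dvd_fact_part]).  Finally [e p <= 2n] forces [p^e] to divide [(2n)!]. *)

Set Implicit Arguments.
Unset Strict Implicit.
Unset Printing Implicit Defensive.

Import Order.TTheory GRing.Theory Num.Theory.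

Local Open Scope nat_scope.

(** For [d = 4q+1], [(n + 3q) %/ d] is the number of multiples of [d] among the
    first [n] terms of [1, 5, 9, ...]: it increases exactly when
    [d %| n + 1 + 3q], and [4 (n + 1 + 3q) = (4n + 1) + 3d]. *)
Lemma count_multiples_1mod4S q n (d := 4 * q + 1) :
  (n.+1 + 3 * q) %/ d = (d %| 4 * n + 1) + (n + 3 * q) %/ d.
Proof.
rewrite addSn divnS ?/d ?addn1 //; congr (nat_of_bool _ + _).
have co : coprime (4 * q).+1 4.
  by rewrite coprime_sym /coprime -[(4 * q).+1]addn1 mulnC gcdnMDl.
rewrite -(Gauss_dvdr _ co).
have -> : 4 * (n + 3 * q).+1 = (4 * n).+1 + 3 * (4 * q).+1 by lia.
by rewrite dvdn_addl // dvdn_mull.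
Qed.

(** With [a = 2n %/ d], what is needed is a number of multiples at least
    [a / 2] rounded up.  Only odd [a = 2b+1] is delicate: then
    [n >= bd + d/2], that is, [n >= bd + 2q + 1], past the index [bd + q] of
    the [(b+1)]-st multiple. *)
Lemma double_div_1mod4_le q n (d := 4 * q + 1) :
  (2 * n) %/ d <= 2 * ((n + 3 * q) %/ d).
Proof.
have d0 : 0 < d by rewrite /d addn1.
move: (leq_trunc_div (2 * n) d); set a := (2 * n) %/ d => le_ad.
have : uphalf a <= (n + 3 * q) %/ d.
  rewrite leq_divRL //; move: le_ad; rewrite /d.
  have := odd_double_half a; rewrite uphalf_half -mul2n.
  by case: (odd a); rewrite ?add1n ?add0n => <-; nia.
by have := odd_double_half a; rewrite uphalf_half -mul2n; lia.
Qed.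

Lemma sum_dvd_pow_le_logn p m N : prime p -> 0 < m ->
  \sum_(1 <= k < N) (p ^ k %| m) <= logn p m.
Proof.
move=> pp m0.
under eq_bigr => k _ do rewrite pfactor_dvdn //.
have le_minn : \sum_(1 <= k < N) (k <= logn p m) <= minn N.-1 (logn p m).
  elim: N => [|[|N] IH]; [by rewrite big_geq.. |].
  by rewrite big_nat_recr //=; case: leqP; lia.
exact: leq_trans le_minn (geq_minr _ _).
Qed.

Lemma expn_1mod4E p k : p = 1 %[mod 4] -> p ^ k = 4 * (p ^ k %/ 4) + 1.
Proof.
move=> p4; have pk : p ^ k %% 4 = 1 by rewrite -modnXm p4 modnXm exp1n.
by rewrite {1}(divn_eq (p ^ k) 4) pk mulnC.
Qed.

(** The bound [N] on the exponents is arbitrary, so that the sum can be compared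
    with Legendre's formula for [(2n)!] term by term. *)
Lemma sum_count_le_logn_prod p N n : prime p -> p = 1 %[mod 4] ->
  \sum_(1 <= k < N) (n + 3 * (p ^ k %/ 4)) %/ (p ^ k) <=
    logn p (\prod_(0 <= j < n) (4 * j + 1)).
Proof.
move=> pp p4.
have pkE k := expn_1mod4E k p4.
elim: n => [|n IH].
  rewrite big_nil logn1 big1 // => k _; rewrite divn_small // {2}pkE; lia.
have prod_gt0 : 0 < \prod_(0 <= j < n) (4 * j + 1).
  by apply: prodn_gt0 => j; rewrite addn1.
rewrite big_nat_recr //= lognM ?addn_gt0 ?orbT // addnC.
apply: leq_trans (leq_add (sum_dvd_pow_le_logn N pp _) IH); last by rewrite addn_gt0 orbT.
rewrite -big_split /= leq_eqVlt; apply/orP; left; apply/eqP.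
by apply: eq_bigr => k _; rewrite {2 3 5}pkE -count_multiples_1mod4S -pkE.
Qed.

(** The [p]-integrality of [2^n (1 * 5 * ... * (4n-3))^2 / (2n)!], read off from
    Legendre's formula by comparing the contributions of each power of [p]. *)
Lemma logn_fact_double_le p n : prime p -> p = 1 %[mod 4] ->
  logn p (2 * n)`! <= 2 * logn p (\prod_(0 <= j < n) (4 * j + 1)).
Proof.
move=> pp p4; rewrite logn_fact //.
apply: (@leq_trans (2 * \sum_(1 <= k < (2 * n).+1)
                          (n + 3 * (p ^ k %/ 4)) %/ (p ^ k))); last first.
  by rewrite leq_mul2l sum_count_le_logn_prod.
rewrite big_distrr /=; apply: leq_sum => k _.
by rewrite {1 3}(expn_1mod4E k p4) double_div_1mod4_le.
Qed.

Lemma leq_logn_fact p e m : prime p -> 0 < e -> e * p <= m ->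
  e <= logn p m`!.
Proof.
move=> pp e0 em.
have m0 : 0 < m by apply: leq_trans em; rewrite muln_gt0 e0 prime_gt0.
rewrite logn_fact // big_ltn ?ltnS // expn1.
by apply: leq_trans (leq_addr _ _); rewrite leq_divRL // prime_gt0.
Qed.

Lemma logn_fact_bin p n m : m <= n ->
  logn p n`! = logn p 'C(n, m) + (logn p m`! + logn p (n - m)`!).
Proof.
by move=> mn; rewrite -(bin_fact mn) !lognM ?muln_gt0 ?fact_gt0 ?bin_gt0.
Qed.

Local Open Scope ring_scope.

Lemma v_recurrence_double v n : v_recurrence v -> (0 < n)%N ->
  2 * v n = (2 ^ n * (\prod_(0 <= j < n) (4 * j + 1)) ^ 2)%N%:Z
            - \sum_(1 <= m < n) 'C(2 * n, 2 * m)%:Z * v m * v (n - m)%N.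
Proof.
case=> _ vS n0; apply: (@intr_inj rat).
rewrite rmorphM /= vS // mulrBr mulrA -exprS prednK // mulrA mul1r mulfV // mul1r.
rewrite rmorphB rmorph_sum /=; congr (_ - _).
  rewrite big_add1 /= PoszM rmorphM /= -!pmulrn !natrX natr_prod -prodrXl; congr (_ * _).
  apply: eq_bigr => j _.
  by rewrite natrD natrM -addn1 natrD; ring.
by apply: eq_bigr => m _; rewrite !rmorphM.
Qed.

(** The coefficients of a square root of a [p]-integral power series with
    constant term 1 are [p]-integral for odd [p]; multiplied by [(2n)!] the
    induction takes place in the integers, since ['C(2n, 2m)] is
    [(2n)! / ((2m)! (2n-2m)!)]. *)
Lemma v_dvd_fact_part v p n : v_recurrence v -> prime p -> p = 1 %[mod 4] ->
  ((p ^ logn p (2 * n)`!)%N%:Z %| v n)%Z.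
Proof.
move=> hv pp p4; elim/ltn_ind: n => -[|n] IH.
  by rewrite muln0 fact0 logn1 expn0 dvd1z.
have co2 : coprimez (p ^ logn p (2 * n.+1)`!)%N%:Z 2.
  rewrite coprimezE /= coprimeXl // coprime_sym prime_coprime // dvdn2.
  by have := divn_eq p 4; rewrite p4; lia.
rewrite -(Gauss_dvdzr _ co2) v_recurrence_double //; apply: rpredB.
  rewrite dvdzE /= dvdn_mull // pfactor_dvdn //; last first.
    by rewrite expn_gt0 prodn_gt0 // => j; rewrite addn1.
  by rewrite lognX logn_fact_double_le.
rewrite big_nat; apply: rpred_sum => m /andP[m0 mn].
have le2 : (2 * m <= 2 * n.+1)%N by rewrite leq_mul2l ltnW.
rewrite (logn_fact_bin p le2) -mulnBr !expnD !PoszM -mulrA.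
apply: dvdz_mul; first by rewrite dvdzE pfactor_dvdnn.
by apply: dvdz_mul; apply: IH => //; rewrite ltn_subrL m0.
Qed.

Theorem theorem19 (v : nat -> int) (hv : v_recurrence v)
    (p : nat) (hp : prime p) (hp4 : p = 1 %[mod 4])
    (e : nat) (he : (0 < e)%N)
    (n : nat) (hn : (uphalf (e * p) <= n)%N) :
  (((p ^ e)%N)%:Z %| v n)%Z.
Proof.
apply: dvdz_trans (v_dvd_fact_part n hv hp hp4).
rewrite dvdzE /= dvdn_exp2l // leq_logn_fact //.
by rewrite mul2n -leq_uphalf_double.
Qed.
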